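(* The maximum number of mutually unbiased unit weighing matrices of order $7$ and weight $4$ is $8$; that is, there exists a set of $8$ mutually unbiased unit weighing matrices of order $7$ and weight $4$, and every set of mutually unbiased unit weighing matrices of order $7$ and weight $4$ has at most $8$ elements.
   Context: A (unit) weighing matrix of order $n$ and weight $w$, denoted $UW(n,w)$, is an $n\times n$ complex matrix $W$ all of whose entries have absolute value $0$ or $1$ and which satisfies $WW^*=wI_n$, where $W^*$ is the conjugate transpose. Two unit weighing matrices $H,K$ of order $n$ and weight $w$ are unbiased if $HK^*=\sqrt{w}\,L$ for some unit weighing matrix $L$ of order $n$ and weight $w$. A set of unit weighing matrices of the same order and weight is mutually unbiased if any two distinct members are unbiased. *)

(* Defs.v *)
From HB Require Import structures.
From mathcomp Require Export all_boot all_order all_algebra.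
From mathcomp Require Export boolp classical_sets functions cardinality reals.
From mathcomp Require Export complex.

Set Implicit Arguments.
Unset Strict Implicit.
Unset Printing Implicit Defensive.

Import Order.TTheory GRing.Theory Num.Theory.

Local Open Scope classical_set_scope.
Local Open Scope ring_scope.
Local Open Scope sesquilinear_scope.

Section UnitWeighingMatrices.
Variables (C : numClosedFieldType) (n w : nat).

(* [W ^t*] is the conjugate transpose of [W]. *)
Definition unit_weighing (W : 'M[C]_n) : Prop :=
  (forall i j, `|W i j| = 0 \/ `|W i j| = 1) /\ W *m W ^t* = w%:R%:M.

Definition unbiased (H K : 'M[C]_n) : Prop :=
  [/\ unit_weighing H, unit_weighing K &
      exists2 L : 'M[C]_n,
        unit_weighing L & H *m K ^t* = sqrtC (w%:R : C) *: L].

Definition mutually_unbiased (S : set 'M[C]_n) : Prop :=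
  (forall H, S H -> unit_weighing H) /\
  (forall H K, S H -> S K -> H <> K -> unbiased H K).

End UnitWeighingMatrices.

(* Main.v *)
Require Import Defs.
From mathcomp Require Import all_boot all_order all_algebra.
From mathcomp Require Import boolp classical_sets functions cardinality reals.
From mathcomp Require Import complex.
From mathcomp Require Import zify ring spectral.

Set Implicit Arguments.
Unset Strict Implicit.
Unset Printing Implicit Defensive.

Import Order.TTheory GRing.Theory Num.Theory.

Local Open Scope ring_scope.
Local Open Scope card_scope.
Local Open Scope sesquilinear_scope.

(** Upper bound.  In a unit weighing matrix of order 7 and weight 4 every row
is supported on 4 of the 7 coordinates.  Two 4-sets meet, and two vectors with
unimodular entries whose supports share a single coordinate have inner product
of modulus 1; so if their inner product has modulus 0 or 2, their supports
share at least two coordinates.  Within one matrix this forces, by counting,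
that any two rows, and likewise any two columns, share exactly two positions:
the supports are the blocks of a symmetric 2-(7,4,2) design, the complements of
the lines of a Fano plane.  For matrices that are unbiased, counting again
(lemma [exists_supp_row]) shows that every support occurring in one of them
occurs in the other, so that all the members of a mutually unbiased set share
the same seven supports.

Now fix one member H and one of its rows h, with support A, and let v be the
row with support A of another member.  For i, j in A the design provides a row
of H whose support meets A in {i, j} exactly; comparing its inner products with
h and with v yields v_i / v_j = h_i / h_j or v_i / v_j = - h_i / h_j
([row_ratio_sign]).  Hence, up to a scalar, v is one of 2 ^ 3 vectors.  Two
members cannot yield the same one, because proportional rows have an inner
product of modulus 4, and so there are at most 8 members.

Attainment.  The bound says that in an extremal family each support carries all
the sign vectors, up to sign.  Let W be a circulant 0, 1, -1 weighing matrix
whose row supports are the complements of the lines of a Fano plane, and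
consider W D, where D runs through the 8 diagonal sign matrices given by a
simplex code: the words of weight 4 in this code are the complements of the
lines of another Fano plane, which has no line in common with the first one.
In W D and W D' two different supports share two coordinates, so the inner
products of such rows are 0, 2 or -2; on a common support of size 4 the word of
D D' is neither constantly 1 nor constantly 0, so again the inner product is 0,
2 or -2. *)

(** * Hermitian products of vectors with unimodular or zero entries *)

Section HermitianProduct.
Variable C : numClosedFieldType.

Definition unit_or_zero n (u : 'I_n -> C) := forall j, `|u j| = 0 \/ `|u j| = 1.

Definition supp n (u : 'I_n -> C) : {set 'I_n} := [set j | u j != 0]%SET.

Definition hdot n (u v : 'I_n -> C) : C := \sum_j u j * (v j)^*.

Variable n : nat.
Implicit Types (u v : 'I_n -> C) (i j : 'I_n).

Lemma unit_or_zero_norm u j : unit_or_zero u -> j \in supp u -> `|u j| = 1.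
Proof. by move=> /(_ j) [/normr0_eq0 uj0|//]; rewrite inE uj0 eqxx. Qed.

Lemma hdotE u v : hdot u v = \sum_(j in supp u :&: supp v) u j * (v j)^*.
Proof.
rewrite /hdot [LHS](bigID (mem (supp u :&: supp v))) /= [X in _ + X]big1 ?addr0 //.
move=> j; rewrite !inE negb_and !negbK => /orP[] /eqP ->; first by rewrite mul0r.
by rewrite rmorph0 mulr0.
Qed.

Lemma norm_hdotC u v : `|hdot u v| = `|hdot v u|.
Proof.
rewrite -norm_conjC rmorph_sum; congr `|_|; apply: eq_bigr => j _.
by rewrite rmorphM /= conjCK mulrC.
Qed.

Lemma hdot_self u : unit_or_zero u -> hdot u u = #|supp u|%:R.
Proof.
move=> uU; rewrite hdotE finset.setIid -sum1_card natr_sum.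
by apply: eq_bigr => j ju; rewrite -normCK unit_or_zero_norm // expr1n.
Qed.

Lemma norm_hdot_supp1 u v : unit_or_zero u -> unit_or_zero v ->
  #|supp u :&: supp v| = 1%N -> `|hdot u v| = 1.
Proof.
move=> uU vU /eqP /cards1P[j uvj].
have /finset.setIP[ju jv] : j \in supp u :&: supp v by rewrite uvj set11.
by rewrite hdotE uvj big_set1 normrM norm_conjC !unit_or_zero_norm ?mulr1.
Qed.

Lemma hdot_supp2 u v i j : i != j -> supp u :&: supp v = [set i; j]%SET ->
  hdot u v = u i * (v i)^* + u j * (v j)^*.
Proof.
by move=> ij uv; rewrite hdotE uv big_setU1 ?inE //= big_set1.
Qed.

(** Equality in the triangle inequality. *)
Lemma norm_addr_eq2 (x y : C) : `|x| = 1 -> `|y| = 1 -> `|x + y| = 2 -> x = y.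
Proof.
move=> x1 y1 xy2; have [|t _] := @normCDeq C x y; first by rewrite x1 y1 xy2.
by rewrite x1 y1 !mul1r => -[-> ->].
Qed.

(** When the hypothesis is read as u_j / v_j = u_a / v_a, all the terms of the
product are the same unimodular number. *)
Lemma hdot_proportional u v a : unit_or_zero u -> unit_or_zero v ->
  supp u = supp v -> a \in supp v ->
  (forall j, j \in supp v -> u j * v a = v j * u a) ->
  `|hdot u v| = #|supp v|%:R.
Proof.
move=> uU vU uv av prop.
have v1 j : j \in supp v -> v j * (v j)^* = 1.
  by move=> jv; rewrite -normCK unit_or_zero_norm // expr1n.
have -> : hdot u v = \sum_(j in supp v) u a * (v a)^*.
  rewrite hdotE uv finset.setIid; apply: eq_bigr => j jv.
  by rewrite -[u j]mulr1 -(v1 a av) mulrA prop // -[RHS]mulr1 -(v1 j jv); ring.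
rewrite sumr_const -[_ *+ _]mulr_natl !normrM norm_conjC.
by rewrite !unit_or_zero_norm ?uv // !mulr1 normr_nat.
Qed.

End HermitianProduct.

(** * Unit weighing matrices *)

Section UnitWeighing.
Variable C : numClosedFieldType.

Lemma mulmx_adjE n (H K : 'M[C]_n) i j : (H *m K ^t*) i j = hdot (H i) (K j).
Proof. by rewrite !mxE; apply: eq_bigr => k _; rewrite !mxE. Qed.

Lemma unit_weighingP n w (W : 'M[C]_n) : unit_weighing w W <->
  (forall i, unit_or_zero (W i)) /\
  (forall i k, hdot (W i) (W k) = w%:R *+ (i == k)).
Proof.
split=> [[W1 WW]|[W1 WW]]; split=> //.
  by move=> i k; rewrite -mulmx_adjE WW mxE.
by apply/matrixP=> i k; rewrite mulmx_adjE WW mxE.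
Qed.

(** The columns of W obey the same combinatorics as its rows, since a right
inverse of a square matrix is a left inverse. *)
Lemma unit_weighing_adj n w (W : 'M[C]_n) : (0 < w)%N ->
  unit_weighing w W -> unit_weighing w (W ^t*).
Proof.
move=> w0 [W1 WW]; split=> [i j|].
  by rewrite !mxE norm_conjC; apply: W1.
have wN0 : w%:R != 0 :> C by rewrite pnatr_eq0 -lt0n.
have : (w%:R^-1 *: W ^t*) *m W = 1%:M.
  by apply: mulmx1C; rewrite -scalemxAr WW scale_scalar_mx mulVf.
rewrite -scalemxAl => WV; rewrite trmxCK.
by rewrite -(scalerKV wN0 (W ^t* *m W)) WV scale_scalar_mx mulr1.
Qed.

Lemma card_supp_row n w (W : 'M[C]_n) i : unit_weighing w W -> #|supp (W i)| = w.
Proof.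
case/unit_weighingP=> W1 /(_ i i); rewrite hdot_self // eqxx.
by move/eqP; rewrite eqr_nat => /eqP.
Qed.

Lemma supp_adj_row n (W : 'M[C]_n) j : supp (W ^t* j) = [set r | j \in supp (W r)]%SET.
Proof. by apply/setP=> r; rewrite !inE !mxE conjC_eq0. Qed.

Lemma card_supp_col n w (W : 'M[C]_n) j : (0 < w)%N -> unit_weighing w W ->
  #|[set r | j \in supp (W r)]%SET| = w.
Proof. by move=> w0 /(unit_weighing_adj w0)/(card_supp_row j); rewrite supp_adj_row. Qed.

(** The matrix L of the definition can only be (H K ^t* ) / sqrt w, and it then
automatically satisfies the weighing equation; only the modulus of its entries
is a condition. *)
Lemma unbiasedP n w (H K : 'M[C]_n) : (0 < w)%N ->
  unit_weighing w H -> unit_weighing w K ->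
  unbiased w H K <->
  (forall i j, `|hdot (H i) (K j)| = 0 \/ `|hdot (H i) (K j)| = sqrtC w%:R).
Proof.
move=> w0 UH UK.
have s0 : sqrtC w%:R != 0 :> C by rewrite sqrtC_eq0 pnatr_eq0 -lt0n.
have sP : `|sqrtC w%:R| = sqrtC w%:R :> C by rewrite ger0_norm // sqrtC_ge0 ler0n.
split=> [[_ _ [L [L1 _] HK]] i j|hHK].
  rewrite -mulmx_adjE HK mxE normrM sP.
  by have [->|->] := L1 i j; [left; rewrite mulr0|right; rewrite mulr1].
split=> //; exists ((sqrtC w%:R)^-1 *: (H *m K ^t*)); last first.
  by rewrite scalerA divff // scale1r.
split=> [i j|].
  rewrite mxE normrM mulmx_adjE normfV sP.
  by have [->|->] := hHK i j; [left; rewrite mulr0|right; rewrite mulVf].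
have [_ KK] := unit_weighing_adj w0 UK; rewrite trmxCK in KK.
have [_ HH] := UH.
have adjZ : ((sqrtC w%:R)^-1 *: (H *m K ^t*)) ^t* =
    (sqrtC w%:R)^-1 *: (K *m H ^t*).
  rewrite linearZ /= map_mxZ trmx_mul map_mxM trmxCK; congr (_ *: _).
  by apply: geC0_conj; rewrite invr_ge0 sqrtC_ge0 ler0n.
rewrite adjZ -scalemxAl -scalemxAr scalerA mulmxA -(mulmxA H) KK.
rewrite mul_mx_scalar -scalemxAl HH !scale_scalar_mx mulrA -expr2 exprVn sqrtCK.
by rewrite mulVf ?mul1r // pnatr_eq0 -lt0n.
Qed.

End UnitWeighing.

(** * The design of the supports in order 7 and weight 4 *)

Section Order7Weight4.
Variable C : numClosedFieldType.

Lemma sqrtC4 : sqrtC (4%:R : C) = 2.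
Proof. by rewrite -[4%:R](_ : 2 ^+ 2 = _) ?sqrCK ?ler0n // -natrX. Qed.

(** Two 4-subsets of a 7-set meet; if they met once, the product would have
modulus 1. *)
Lemma supp_capI_ge2 (u v : 'I_7 -> C) : unit_or_zero u -> unit_or_zero v ->
  #|supp u| = 4%N -> #|supp v| = 4%N -> `|hdot u v| = 0 \/ `|hdot u v| = 2 ->
  (2 <= #|supp u :&: supp v|)%N.
Proof.
move=> uU vU u4 v4 huv.
have := cardsUI (supp u) (supp v); rewrite u4 v4.
have := subset_leq_card (finset.subsetT (supp u :|: supp v)).
rewrite cardsT card_ord.
set c := #|supp u :&: supp v| => ? ?; suff : c <> 1%N by lia.
move=> /(norm_hdot_supp1 uU vU) h1; move: huv; rewrite h1.
by case=> /eqP; rewrite ?oner_eq0 // -[1]/(1%:R) eqr_nat.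
Qed.

(** Double counting of the incidences, each column having 4 nonzero entries. *)
Lemma sum_card_supp_cap (W : 'M[C]_7) (A : {set 'I_7}) : unit_weighing 4 W ->
  (\sum_r #|A :&: supp (W r)| = #|A| * 4)%N.
Proof.
move=> UW; under eq_bigr => r _ do rewrite -sum1_card big_mkcond /=.
rewrite exchange_big /= (bigID (mem A)) /= [X in (_ + X)%N]big1 ?addn0; last first.
  by move=> j /negPf jA; rewrite big1 // => r _; rewrite finset.in_setI jA.
rewrite -sum_nat_const; apply: eq_bigr => j jA.
rewrite -[RHS](@card_supp_col _ _ _ W j _ UW) // -sum1dep_card [RHS]big_mkcond /=.
by apply: eq_bigr => r _; rewrite finset.in_setI jA.
Qed.

(** The support of row i meets the six other ones at least twice, and 12 times
altogether. *)
Lemma card_supp_cap (W : 'M[C]_7) i k : unit_weighing 4 W -> i != k ->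
  #|supp (W i) :&: supp (W k)| = 2%N.
Proof.
move=> UW ik; have := sum_card_supp_cap (supp (W i)) UW.
have [W1 WW] := (unit_weighingP _ _).1 UW.
rewrite (bigD1 i) //= (bigD1 k) 1?eq_sym //= finset.setIid !(card_supp_row _ UW).
have ge2 r : i != r -> (2 <= #|supp (W i) :&: supp (W r)|)%N.
  move=> /negPf ir; apply: supp_capI_ge2; rewrite ?(card_supp_row _ UW) //.
  by left; rewrite WW ir normr0.
have := ge2 _ ik.
have : (\sum_(r | (r != i) && (r != k)) 2 <=
        \sum_(r | (r != i) && (r != k)) #|supp (W i) :&: supp (W r)|)%N.
  by apply: leq_sum => r /andP[ri _]; apply: ge2; rewrite eq_sym.
rewrite sum_nat_const.
have -> : #|[pred r : 'I_7 | (r != i) && (r != k)]| = 5%N.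
  have := cardsC [set i; k]%SET; rewrite cards2 ik card_ord => cE.
  apply: (@addnI 2); apply: etrans cE; congr addn.
  by apply: eq_card => r; rewrite !inE negb_or.
set x := #|supp _ :&: supp (W k)|; set y := (\sum_(_ < 7 | _) _)%N.
by lia.
Qed.

Lemma card_cols (W : 'M[C]_7) i j : unit_weighing 4 W -> i != j ->
  #|[set r | (i \in supp (W r)) && (j \in supp (W r))]%SET| = 2%N.
Proof.
move=> UW ij; rewrite -[RHS](card_supp_cap (unit_weighing_adj (isT : (0 < 4)%N) UW) ij).
by rewrite !supp_adj_row; apply: eq_card => r; rewrite !inE.
Qed.

(** Two columns share two rows, of which r is one; the other one meets r in two
columns, hence in these only. *)
Lemma supp_cap_pair (W : 'M[C]_7) r i j : unit_weighing 4 W -> i != j ->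
  i \in supp (W r) -> j \in supp (W r) ->
  exists2 s, s != r & supp (W r) :&: supp (W s) = [set i; j]%SET.
Proof.
move=> UW ij ir jr; have /eqP/cards2P[s [t [st E]]] := card_cols UW ij.
have [s' s'r] : exists2 s', s' != r & s' \in [set s; t]%SET.
  have [sr|sr] := eqVneq s r; last by exists s; rewrite ?set21.
  by exists t; rewrite ?set22 // -sr eq_sym.
rewrite -E inE => /andP[is' js']; exists s' => //.
apply/esym/eqP; rewrite eqEcard cards2 ij card_supp_cap 1?eq_sym // andbT.
apply/fintype.subsetP => x; rewrite finset.in_setI.
by case/set2P=> ->; apply/andP.
Qed.

(** The square counts the ordered pairs of columns in A, and two distinct
columns share two rows whereas a column shares four rows with itself. *)
Lemma sum_card_supp_cap2 (W : 'M[C]_7) (A : {set 'I_7}) : unit_weighing 4 W ->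
  (\sum_r #|A :&: supp (W r)| ^ 2 = #|A| * (#|A| * 2 + 2))%N.
Proof.
move=> UW.
have sqE (B : {set 'I_7}) : (#|B| ^ 2 = \sum_i \sum_j (i \in B) && (j \in B))%N.
  rewrite -mulnn -{1 2}sum1_card big_distrlr /= big_mkcond /=; apply: eq_bigr => i _.
  rewrite big_mkcond /=; case: (i \in B) => /=; last by rewrite big1.
  by apply: eq_bigr => j _; case: (j \in B).
under eq_bigr do rewrite sqE.
rewrite exchange_big /=; under eq_bigr do rewrite exchange_big /=.
have colE i j : i \in A -> j \in A ->
    (\sum_r ((i \in A :&: supp (W r)) && (j \in A :&: supp (W r)) : nat) =
     2 + (i == j) * 2)%N.
  move=> iA jA; under eq_bigr do rewrite !finset.in_setI iA jA /=.
  rewrite -big_mkcond /= sum1dep_card.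
  have [<-|ij] := eqVneq i j; last by rewrite card_cols.
  rewrite -[RHS](@card_supp_col _ _ _ W i (isT : (0 < 4)%N) UW); apply: eq_card => r.
  by rewrite !inE andbb.
rewrite (bigID (mem A)) /= [X in (_ + X)%N]big1 ?addn0; last first.
  move=> i /negPf iA; rewrite big1 // => j _; rewrite big1 // => r _.
  by rewrite finset.in_setI iA.
rewrite -sum_nat_const; apply: eq_bigr => i iA.
rewrite (bigID (mem A)) /= [X in (_ + X)%N]big1 ?addn0; last first.
  by move=> j /negPf jA; rewrite big1 // => r _; rewrite !finset.in_setI jA andbF.
under eq_bigr => j jA do rewrite colE //.
rewrite big_split /= sum_nat_const (bigD1 i) //= eqxx big1 // => j /andP[_ /negPf ji].
by rewrite eq_sym ji.
Qed.

(** Let s_r >= 2 be the number of coordinates shared by v and row r.  The two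
counting lemmas give that the s_r sum to 16 and their squares to 40, whence the
sum of (s_r - 2) (s_r - 3) over the 7 rows is 40 - 80 + 42 = 2.  If no support
were that of v, all the s_r would be 2 or 3 and this sum would vanish. *)
Lemma exists_supp_row (K : 'M[C]_7) (v : 'I_7 -> C) : unit_weighing 4 K ->
  unit_or_zero v -> #|supp v| = 4%N ->
  (forall r, `|hdot v (K r)| = 0 \/ `|hdot v (K r)| = 2) ->
  exists r, supp (K r) = supp v.
Proof.
move=> UK vU v4 hv; have [K1 _] := (unit_weighingP _ _).1 UK.
have s1 := sum_card_supp_cap (supp v) UK.
have s2 := sum_card_supp_cap2 (supp v) UK.
rewrite v4 /= in s1 s2.
have [r rv|none] := pickP (fun r => supp v \subset supp (K r)).
  by exists r; apply/esym/eqP; rewrite eqEcard rv v4 (card_supp_row _ UK).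
(* (s - 2) (s - 3) <= 0, written without subtraction *)
have ub r : (#|supp v :&: supp (K r)| ^ 2 + 6 <= 5 * #|supp v :&: supp (K r)|)%N.
  have ge2 : (2 <= #|supp v :&: supp (K r)|)%N.
    by apply: supp_capI_ge2 => //; apply: card_supp_row.
  have : (#|supp v :&: supp (K r)| < 4)%N.
    rewrite -[ltnRHS]v4 proper_card // finset.properEneq finset.subsetIl andbT.
    by apply: contraFN (none r) => /eqP <-; apply: finset.subsetIr.
  by move: ge2; set c := #|_| => *; nia.
have : (\sum_(r < 7) (#|supp v :&: supp (K r)| ^ 2 + 6) <=
        \sum_(r < 7) 5 * #|supp v :&: supp (K r)|)%N by apply: leq_sum.
by rewrite big_split /= -big_distrr /= s1 s2 sum_nat_const card_ord.
Qed.

(** Take a row s of W whose support meets that of row r in i and j only: the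
product of v with it is a sum of two unimodular numbers and has modulus 0 or 2,
so these two numbers are opposite or equal; for row r they are opposite. *)
Lemma row_ratio_sign (W : 'M[C]_7) r (v : 'I_7 -> C) i j : unit_weighing 4 W ->
  unit_or_zero v -> supp v = supp (W r) ->
  (forall s, s != r -> `|hdot v (W s)| = 0 \/ `|hdot v (W s)| = 2) ->
  i \in supp v -> j \in supp v ->
  v i * W r j = W r i * v j \/ v i * W r j = - (W r i * v j).
Proof.
move=> UW vU vr hv iv jv.
have [<-|ij] := eqVneq i j; first by left; rewrite mulrC.
have [s sr E] : exists2 s, s != r & supp (W r) :&: supp (W s) = [set i; j]%SET.
  by apply: supp_cap_pair; rewrite -?vr.
have [W1 WW] := (unit_weighingP _ _).1 UW.
have /finset.setIP[ir is_] : i \in supp (W r) :&: supp (W s) by rewrite E set21.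
have /finset.setIP[jr js] : j \in supp (W r) :&: supp (W s) by rewrite E set22.
have Ev : supp v :&: supp (W s) = [set i; j]%SET by rewrite vr.
have [vi1 vj1 si1 sj1] : [/\ `|v i| = 1, `|v j| = 1, `|W s i| = 1 & `|W s j| = 1].
  by split; apply: unit_or_zero_norm.
have := hv s sr; rewrite (hdot_supp2 ij Ev) => hvs.
have := WW r s; rewrite eq_sym (negPf sr) (hdot_supp2 ij E) => /eqP.
move: hvs is_ js; rewrite !inE -(conjC_eq0 (W s i)) -(conjC_eq0 (W s j)).
set p := (W s i)^*; set q := (W s j)^* => hvs p0 q0.
rewrite mulr0n addr_eq0 => /eqP hW.
have cancel_pq x y : x * (p * q) = y * (p * q) -> x = y.
  by apply: mulIf; rewrite mulf_neq0.
case: hvs => [/normr0_eq0/eqP|h2].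
  rewrite addr_eq0 => /eqP hv0; left; apply: cancel_pq.
  transitivity ((v i * p) * (W r j * q)); first by ring.
  transitivity ((W r i * p) * (v j * q)); last by ring.
  by rewrite hv0 hW; ring.
have {h2} hv2 : v i * p = v j * q.
  by apply: norm_addr_eq2; rewrite // normrM norm_conjC ?vi1 ?vj1 ?si1 ?sj1 mulr1.
right; apply: cancel_pq.
transitivity ((v i * p) * (W r j * q)); first by ring.
transitivity (- ((W r i * p) * (v j * q))); last by ring.
by rewrite hv2 hW; ring.
Qed.

End Order7Weight4.

(** * The upper bound *)

Local Open Scope classical_set_scope.

Section UpperBound.
Variable C : numClosedFieldType.

Lemma card_le_powerset (T : choiceType) (I : finType) (S : set T) (B : {set I})
    (f : T -> {set I}) :
  (forall x, S x -> f x \subset B) ->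
  (forall x y, S x -> S y -> f x = f y -> x = y) -> S #<= `I_(2 ^ #|B|).
Proof.
move=> fB finj; pose g x := index (f x) (enum (powerset B)).
have fP x : S x -> f x \in enum (powerset B).
  by move=> Sx; rewrite mem_enum powersetE fB.
have /inj_card_eq/card_eqPle[_ le1] : {in S &, injective g}.
  move=> x y; rewrite !in_setE => Sx Sy gxy; apply: finj => //.
  by rewrite -(nth_index (f x) (fP x Sx)) -/(g x) gxy nth_index // fP.
apply: card_le_trans le1 _; apply: subset_card_le => _ [x Sx <-] /=.
by rewrite -card_powerset cardE index_mem fP.
Qed.

Lemma unbiased_hdot (H K : 'M[C]_7) : unbiased 4 H K ->
  forall i j, `|hdot (H i) (K j)| = 0 \/ `|hdot (H i) (K j)| = 2.
Proof.
move=> UHK; have [UH UK _] := UHK.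
by have := (unbiasedP (isT : (0 < 4)%N) UH UK).1 UHK; rewrite sqrtC4.
Qed.

(** The case H = K is included, so that a row can be chosen uniformly in all the
members of a mutually unbiased set. *)
Lemma exists_sign_row (H K : 'M[C]_7) r a :
  unit_weighing 4 H -> unit_weighing 4 K -> (H <> K -> unbiased 4 H K) ->
  a \in supp (H r) ->
  exists s, supp (K s) = supp (H r) /\
    forall j, j \in supp (H r) ->
      K s j * H r a = H r j * K s a \/ K s j * H r a = - (H r j * K s a).
Proof.
move=> UH UK HKub ar; have [<-|/HKub HK] := pselect (H = K).
  by exists r; split=> // j jr; left.
have [[H1 _] [K1 _]] := ((unit_weighingP _ _).1 UH, (unit_weighingP _ _).1 UK).
have hHK := unbiased_hdot HK.
have [s sr] := exists_supp_row UK (H1 r) (card_supp_row r UH) (hHK r).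
exists s; split=> // j jr.
by apply: (row_ratio_sign UH (K1 s) sr); rewrite ?sr // => t _; rewrite norm_hdotC.
Qed.

Theorem mutually_unbiased_card_le (S : set 'M[C]_7) :
  mutually_unbiased 4 S -> S #<= `I_8.
Proof.
move=> [SU SUB]; have [[H SH]|S0] := pselect (exists H, S H); last first.
  suff -> : S = set0 by exact: card_ge0.
  by rewrite -subset0 => H SH; apply: S0; exists H.
have UH := SU _ SH.
pose r := @ord0 6.
have /card_gt0P[a ar] : (0 < #|supp (H r)|)%N by rewrite (card_supp_row r UH).
pose A := supp (H r).
have /choice[rho rhoP] (K : 'M[C]_7) : exists s, S K ->
    supp (K s) = A /\ forall j, j \in A ->
      K s j * H r a = H r j * K s a \/ K s j * H r a = - (H r j * K s a).
  have [SK|nSK] := pselect (S K); last by exists r.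
  have [s sP] := exists_sign_row UH (SU _ SK) (SUB _ _ SH SK) ar.
  by exists s.
(* The line spanned by the chosen row of K is encoded by the coordinates at
   which it has the same ratio as row r of H to coordinate a. *)
pose f (K : 'M[C]_7) :=
  [set j in A :\ a | K (rho K) j * H r a == H r j * K (rho K) a]%SET.
have A3 : #|A :\ a| = 3%N.
  by apply: (@addnI 1); rewrite -[RHS](card_supp_row r UH) -/A (cardsD1 a A) ar.
suff : S #<= `I_(2 ^ #|A :\ a|) by rewrite A3.
apply: (@card_le_powerset _ _ _ _ f) => [K _|K L SK SL fKL].
  by apply/fintype.subsetP => j; rewrite inE => /andP[].
have [//|KL] := pselect (K = L); exfalso.
have [Ks Kr] := rhoP K SK; have [Ls Lr] := rhoP L SL.
have [K1 _] := (unit_weighingP _ _).1 (SU _ SK).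
have [L1 _] := (unit_weighingP _ _).1 (SU _ SL).
have h0 : H r a != 0 by move: ar; rewrite inE.
have prop j : j \in supp (L (rho L)) ->
    K (rho K) j * L (rho L) a = L (rho L) j * K (rho K) a.
  rewrite Ls => jA; apply: (mulIf h0).
  have [->|ja] := eqVneq j a; first by ring.
  have jE M : (j \in f M) = (M (rho M) j * H r a == H r j * M (rho M) a).
    by rewrite !inE ja -[H r j != 0]/(_) /=; move: jA; rewrite inE => ->.
  rewrite [LHS]mulrAC [RHS]mulrAC.
  have := jE K; rewrite fKL jE => E.
  have [/eqP eK|nK] := boolP (K (rho K) j * H r a == H r j * K (rho K) a).
    by move: E; rewrite eK eqxx => /eqP ->; ring.
  have := E; rewrite (negPf nK) => /eqP nL.
  have [eK|->] := Kr j jA; first by rewrite eK eqxx in nK.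
  by have [|->] := Lr j jA => //; ring.
have aL : a \in supp (L (rho L)) by rewrite Ls.
have := hdot_proportional (K1 _) (L1 _) (etrans Ks (esym Ls)) aL prop.
rewrite (card_supp_row _ (SU _ SL)).
by have [->|->] := unbiased_hdot (SUB _ _ SK SL KL) (rho K) (rho L);
  move=> /eqP; rewrite ?eqr_nat // eq_sym pnatr_eq0.
Qed.

End UpperBound.

(** * Eight mutually unbiased matrices *)

Section Construction.

(** The first row of the circulant W.  Its support is the complement of the
Fano line {1, 2, 4} of squares modulo 7. *)
Definition circ_coef (d : nat) : int :=
  if d == 0%N then -1 else if d \in [:: 3; 5; 6]%N then 1 else 0.

(** The signs of the code words, numbered by x: the zero word for x = 0, and for
x = t + 1 the translate by t of {0, 1, 2, 4}, which is the complement of the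
line {3, 5, 6} + t of the Fano plane of nonsquares. *)
Definition sign_coef (x j : nat) : int :=
  if x is t.+1 then (-1) ^+ ((j + 7 - t) %% 7 \in [:: 0; 1; 2; 4])%N else 1.

(** The 7 is added in order to reduce j - i modulo 7 without truncation. *)
Definition frame_coef (x i j : nat) : int :=
  circ_coef ((j + 7 - i) %% 7) * sign_coef x j.

Definition frame_dot (x i y k : nat) : int :=
  \sum_(0 <= j < 7) frame_coef x i j * frame_coef y k j.

Lemma frame_coef_norm x i j : `|frame_coef x i j| = 0 \/ `|frame_coef x i j| = 1.
Proof.
rewrite normrM /circ_coef.
have -> : `|sign_coef x j| = 1 by case: x => [|t] //=; rewrite normrX normrN1 expr1n.
by case: ifP => _; [right | case: ifP => _; [right|left]].
Qed.

(** The products of all the pairs of rows are evaluated.  The two Fano planes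
have no line in common, which is what excludes 4 and -4 for x different from y. *)
Lemma frame_dot_check :
  all (fun x => all (fun i => all (fun y => all (fun k =>
    if x == y then frame_dot x i y k == (if i == k then 4 else 0)
    else (frame_dot x i y k == 0) || (`|frame_dot x i y k| == 2))
  (iota 0 7)) (iota 0 8)) (iota 0 7)) (iota 0 8).
Proof.
(* Unlocking turns the sum over a concrete interval into a computable fold. *)
by rewrite /frame_dot unlock; vm_compute.
Qed.

Lemma frame_dotP x y i k : (x < 8)%N -> (y < 8)%N -> (i < 7)%N -> (k < 7)%N ->
  if x == y then frame_dot x i y k = 4%:R *+ (i == k)
  else `|frame_dot x i y k| = 0 \/ `|frame_dot x i y k| = 2.
Proof.
move=> x8 y8 i7 k7.
have /allP/(_ x)/[!mem_iota]/(_ x8)/allP/(_ i) := frame_dot_check.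
rewrite mem_iota => /(_ i7)/allP/(_ y)/[!mem_iota]/(_ y8)/allP/(_ k).
rewrite mem_iota => /(_ k7).
case: (x == y) => [/eqP->|]; first by case: (i == k).
by case/orP=> /eqP->; [left | right].
Qed.

Variable C : numClosedFieldType.

Definition frame (x : nat) : 'M[C]_7 := \matrix_(i, j) (frame_coef x i j)%:~R.

Lemma hdot_frame x y i k : hdot (frame x i) (frame y k) = (frame_dot x i y k)%:~R.
Proof.
rewrite /frame_dot big_mkord rmorph_sum; apply: eq_bigr => j _.
by rewrite !mxE rmorph_int -rmorphM.
Qed.

Lemma unit_weighing_frame x : (x < 8)%N -> unit_weighing 4 (frame x).
Proof.
move=> x8; apply/unit_weighingP; split=> [i j|i k].
  by rewrite mxE -intr_norm; case: (frame_coef_norm x i j) => ->; [left|right].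
rewrite hdot_frame; have := frame_dotP x8 x8 (ltn_ord i) (ltn_ord k).
by rewrite eqxx => ->; rewrite rmorphMn.
Qed.

Lemma frame_dot_neq x y : (x < 8)%N -> (y < 8)%N -> x != y -> forall i k,
  `|hdot (frame x i) (frame y k)| = 0 \/ `|hdot (frame x i) (frame y k)| = 2.
Proof.
move=> x8 y8 /negPf xy i k; rewrite hdot_frame -intr_norm.
have := frame_dotP x8 y8 (ltn_ord i) (ltn_ord k).
by rewrite xy => -[->|->]; [left|right].
Qed.

(** If the matrices were equal, the inner product of their first rows would be 4. *)
Lemma frame_inj x y : (x < 8)%N -> (y < 8)%N -> frame x = frame y -> x = y.
Proof.
move=> x8 y8 xy; apply: contrapT => /eqP xNy.
have := frame_dot_neq x8 y8 xNy ord0 ord0; rewrite -xy.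
have [_ ->] := (unit_weighingP _ _).1 (unit_weighing_frame x8).
by rewrite normr_nat => -[] /eqP; rewrite ?pnatr_eq0 ?eqr_nat.
Qed.

Theorem exists_mutually_unbiased8 :
  exists S : set 'M[C]_7, mutually_unbiased 4 S /\ S #= `I_8.
Proof.
exists [set frame x | x in `I_8]; split; last first.
  by apply: inj_card_eq => x y; rewrite !in_setE; apply: frame_inj.
split=> [_ [x x8 <-]|_ _ [x x8 <-] [y y8 <-] xy]; first exact: unit_weighing_frame.
have xNy : x != y by apply: contra_notN xy => /eqP ->.
apply/unbiasedP => //; [exact: unit_weighing_frame..|].
by rewrite sqrtC4; apply: frame_dot_neq.
Qed.

End Construction.

Theorem theorem20 (R : realType) :
  (exists S : set 'M[R[i]]_7, mutually_unbiased 4 S /\ S #= `I_8) /\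
  (forall S : set 'M[R[i]]_7, mutually_unbiased 4 S -> S #<= `I_8).
Proof.
split; first exact: exists_mutually_unbiased8.
by move=> S; apply: mutually_unbiased_card_le.
Qed.
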